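(* Assume, for the assertions in $H$ (items 1 and 3), that $f\in L^2_{loc}(\mathbb{R};V')$ and for some $\mu_*\in(0,\mu_0]$, $\int_{-\infty}^te^{\mu_*s}\|f(s)\|_{V'}^2ds<+\infty$ for all $t\in\mathbb{R}$; and, for the assertions in $D(A^{1/4})$ (items 2 and 4), that $f\in L^2_{loc}(\mathbb{R};H)$ and for some $\mu_*\in(0,\mu_0]$, $\int_{-\infty}^te^{\mu_*s}|f(s)|^2ds<+\infty$ for all $t\in\mathbb{R}$. For $X=H$ or $X=D(A^{1/4})$ let $\mathcal{A}^X_\mu$ and $\mathcal{A}^X_F$ be the minimal pullback attractors in $X$, with respect to the universes $\mathcal{D}^X_\mu$ and $\mathcal{D}^X_F$ respectively, of the process generated by the weak solutions (for $X=H$), respectively the regular solutions (for $X=D(A^{1/4})$), of (P). Let $\hat D^X_{\mu_0}=\{D^X_{\mu_0}(t)\}_{t\in\mathbb{R}}$ be the pullback $\mathcal{D}^X_{\mu_0}$-absorbing family in $X$. Let $T\in\mathbb{R}$. Then: 1. $\mathcal{A}^H_F(t)\subset\mathcal{A}^H_\mu(t)\subset\mathcal{A}^H_{\mu_0}(t)$ for $0<\mu\le\mu_0$, $t\in\mathbb{R}$. 2. $\mathcal{A}^{D(A^{1/4})}_F(t)\subset\mathcal{A}^{D(A^{1/4})}_\mu(t)\subset\mathcal{A}^{D(A^{1/4})}_{\mu_0}(t)$ for $0<\mu\le\mu_0$, $t\in\mathbb{R}$. 3. If $\bigcup_{t\le T}D^H_{\mu_0}(t)$ is bounded in $H$, then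 $\mathcal{A}^H_F(t)=\mathcal{A}^H_\mu(t)=\mathcal{A}^H_{\mu_0}(t)$ for $t\le T$, $0<\mu\le\mu_0$. 4. If $\bigcup_{t\le T}D^{D(A^{1/4})}_{\mu_0}(t)$ is bounded in $D(A^{1/4})$, then $\mathcal{A}^{D(A^{1/4})}_F(t)=\mathcal{A}^{D(A^{1/4})}_\mu(t)=\mathcal{A}^{D(A^{1/4})}_{\mu_0}(t)$ for $t\le T$, $0<\mu\le\mu_0$.
   Context: Let $\Omega\subset\mathbb{R}^3$ be a bounded domain with smooth boundary and $\nu,\nu_0>0$. Let $E=\{u\in(C_0^\infty(\Omega))^3:\nabla\cdot u=0\}$; $H$ is the closure of $E$ in $(L^2(\Omega))^3$, with $L^2$ inner product $(\cdot,\cdot)$ and norm $|\cdot|$; $V$ is the closure of $E$ in $(H^1(\Omega))^3$, with inner product $((u,v))=\sum_{i,j}\int_\Omega \partial_i u_j\,\partial_i v_j\,dx$ and norm $\|\cdot\|$; $V'$ is the dual of $V$ with norm $\|\cdot\|_{V'}$ and pairing $\langle\cdot,\cdot\rangle$, and $V\hookrightarrow H\equiv H'\hookrightarrow V'$. $A=-P\Delta$ ($P$ the Leray projection onto $H$) is the Stokes operator with Dirichlet condition, $\langle Au,v\rangle=((u,v))$, with eigenvalues $0<\lambda_1\le\lambda_2\le\cdots$ and eigenfunctions $\omega_j$ forming an orthonormal basis of $H$; $A^s u=\sum_j\lambda_j^s(u,\omega_j)\omega_j$, and $D(A^{1/4})$ carries the norm $|A^{1/4}u|$. $b(u,v,w)=\sum_{i,j}\int_\Omega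 u_i(\partial_i v_j)w_j\,dx$. Put $\mu_0=\nu\lambda_1$. Problem (P): $u_t-(\nu+\nu_0\|\nabla u\|_{L^2}^2)\Delta u+(u\cdot\nabla)u+\nabla p=f(x,t)$ in $\Omega$, $t>\tau$; $\nabla\cdot u=0$; $u|_{\partial\Omega}=0$; $u(x,\tau)=u_0(x)$. A weak solution is $u\in L^\infty(\tau,T;H)\cap L^4(\tau,T;V)$ (for every $T>\tau$) with $u(\tau)=u_0$ and $\frac{d}{dt}(u,v)+(\nu+\nu_0\|u\|^2)((u,v))+b(u,u,v)=\langle f,v\rangle$ for all $v\in V$, in the sense of distributions. For $f\in L^{4/3}_{loc}(\mathbb{R};V')$ and $u_0\in H$ there is a unique weak solution, it lies in $C([\tau,T];H)$, and $S(t,\tau)u_0=u(t)$ defines a continuous process on $H$. For $f\in L^2_{loc}(\mathbb{R};H)$ and $u_0\in D(A^{1/4})$ the solution (called regular) lies in $C([\tau,T];D(A^{1/4}))\cap L^2(\tau,T;D(A^{3/4}))$ and $S(t,\tau)$ is a continuous process on $D(A^{1/4})$. For $X=H$ or $X=D(A^{1/4})$, the universe $\mathcal{D}^X_\mu$ is the class of families $\hat D=\{D(t)\}_{t\in\mathbb{R}}$ of nonempty bounded subsets of $X$ for which there is a continuous $\rho_{\hat D}:\mathbb{R}\to\mathbb{R}^+$ such that $D(t)$ is contained in the closed ball of $X$ with center $0$ and radius $\rho_{\hat D}(t)$ for all $t$, and $\lim_{\tau\to-\infty}|\rho_{\hat D}(\tau)|^2e^{\mu\tau}=0$. The universe $\mathcal{D}^X_F$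 is the class of constant families $D(t)=D$, $t\in\mathbb{R}$, with $D$ a nonempty bounded subset of $X$. Let ${\rm dist}_X(B_1,B_2)=\sup_{x\in B_1}\inf_{y\in B_2}\|x-y\|_X$. Given a universe $\mathcal{D}$ on $X$, a family $\mathcal{A}=\{\mathcal{A}(t)\}_{t\in\mathbb{R}}$ is a pullback $\mathcal{D}$-attractor of $S$ if each $\mathcal{A}(t)$ is nonempty and compact in $X$, $S(t,\tau)\mathcal{A}(\tau)=\mathcal{A}(t)$ for $t\ge\tau$, and $\lim_{\tau\to-\infty}{\rm dist}_X(S(t,\tau)D(\tau),\mathcal{A}(t))=0$ for all $t\in\mathbb{R}$ and $\{D(t)\}\in\mathcal{D}$. It is minimal if $\mathcal{A}(t)\subset C(t)$ for all $t$ whenever $\{C(t)\}$ is a family of closed sets with the same pullback $\mathcal{D}$-attraction property. Under the stated assumptions on $f$ these minimal attractors exist. A family $\{B(t)\}_{t\in\mathbb{R}}$ of subsets of $X$ is pullback $\mathcal{D}$-absorbing if for every $t\in\mathbb{R}$ and $\hat D\in\mathcal{D}$ there is $T(t,\hat D)<t$ with $S(t,\tau)D(\tau)\subset B(t)$ for all $\tau\le T(t,\hat D)$. *)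

(* Defs.v *)
From HB Require Import structures.
From mathcomp Require Import all_boot all_order all_algebra ring_quotient ring lra.
From mathcomp Require Import all_classical all_reals all_analysis.
Set Implicit Arguments. Unset Strict Implicit. Unset Printing Implicit Defensive.
Import Order.TTheory GRing.Theory Num.Theory.
Import numFieldNormedType.Exports.
Import Quotient.Exports.
Local Open Scope classical_set_scope.
Local Open Scope quotient_scope.
Local Open Scope ring_scope.

Definition R3 (R : realType) : Type := (R * R * R)%type.
HB.instance Definition _ (R : realType) := NormedModule.on (R3 R).

(* The same points, with the sigma-algebra on which [lebesgue_measure] lives. *)
Definition mR3 (R : realType) : Type :=
  (measurableTypeR R * measurableTypeR R * measurableTypeR R)%type.
HB.instance Definition _ (R : realType) := Measurable.on (mR3 R).

Definition lebesgue3 {R : realType} : set (mR3 R) -> \bar R :=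
  (((@lebesgue_measure R) \x (@lebesgue_measure R)) \x (@lebesgue_measure R))%E.
HB.instance Definition _ (R : realType) := Measure.on (@lebesgue3 R).

Lemma open_measurable3 (R : realType) (O : set (R3 R)) :
  open O -> measurable (O : set (mR3 R)).
Proof.
move=> oO.
pose I := (rat * rat * rat * nat)%type.
pose box (i : I) : set (mR3 R) :=
  (ball (ratr i.1.1.1 : R) i.2.+1%:R^-1 `*` ball (ratr i.1.1.2 : R) i.2.+1%:R^-1)
  `*` ball (ratr i.1.2 : R) i.2.+1%:R^-1.
pose F (i : I) : set (mR3 R) := if `[< box i `<=` O >] then box i else set0.
have mF i : measurable (F i).
  rewrite /F; case: ifP => // _.
  apply: measurableX; first apply: measurableX;
    rewrite ball_itv; exact: measurable_itv.
suff -> : O = \bigcup_i F i by apply: countable_bigcupT_measurable => //; exact: countableP.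
apply/seteqP; split => [[[x y] z] Ox|x [i _]]; last first.
  by rewrite /F; case: asboolP => // + Fx; apply.
have /nbhs_ballP[e /= e0 eO] : nbhs ((x, y, z) : R3 R) O by exact: open_nbhs_nbhs.
have [n ne] : exists n : nat, n.+1%:R^-1 < e / 2.
  have e20 : 0 < e / 2 by rewrite divr_gt0.
  exists (Num.truncn (e / 2)^-1).
  by rewrite invf_plt ?posrE// truncnS_gt.
have rd (t d : R) : 0 < d -> exists q : rat, ball (ratr q : R) d t.
  move=> d0; have : t - d < t + d by lra.
  move=> /rat_in_itvoo[q] /[!in_itv]/= /andP[q1 q2]; exists q.
  by rewrite /ball/= ltr_norml; apply/andP; split; lra.
have n0 : 0 < (n.+1%:R^-1 : R) by rewrite invr_gt0.
have [qx hx] := rd x _ n0; have [qy hy] := rd y _ n0; have [qz hz] := rd z _ n0.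
exists (qx, qy, qz, n) => //; rewrite /F; case: asboolP => [_|]; first by split.
case=> -[[a b] c] [[/= ha hb] hc]; apply: eO.
have sp (q s t : R) : ball q n.+1%:R^-1 s -> ball q n.+1%:R^-1 t -> ball s e t.
  move=> /ball_sym h1 h2; have := ball_triangle h1 h2.
  by apply: le_ball; rewrite (splitr e) lerD// ltW.
by split; [split|]; rewrite /=; [exact: sp hx ha|exact: sp hy hb|exact: sp hz hc].
Qed.

Section semi_inner_product.
Context (R : realType) (V : lmodType R) (b : V -> V -> R).
Hypothesis bC : forall x y, b x y = b y x.
Hypothesis bD : forall a x y z, b (a *: x + y) z = a * b x z + b y z.
Hypothesis b_ge0 : forall x, 0 <= b x x.

Lemma semi_ip_quad a x y :
  b (a *: x + y) (a *: x + y) = a ^+ 2 * b x x + 2 * a * b x y + b y y.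
Proof.
by rewrite bD [b x (_ + _)]bC [b y (_ + _)]bC !bD (bC y x); ring.
Qed.

Lemma semi_ip_cauchy_schwarz x y : b x y ^+ 2 <= b x x * b y y.
Proof.
have [xx0|xx0] := eqVneq (b x x) 0.
  suff -> : b x y = 0 by rewrite xx0 mul0r expr0n.
  apply/eqP; apply: contraT => xy0.
  have := b_ge0 ((- (b y y + 1) / (2 * b x y)) *: x + y).
  rewrite semi_ip_quad xx0 mulr0 add0r.
  have -> : 2 * (- (b y y + 1) / (2 * b x y)) * b x y = - (b y y + 1).
    by field.
  by lra.
have xxp : 0 < b x x by rewrite lt_def xx0 b_ge0.
have := b_ge0 ((- b x y / b x x) *: x + y); rewrite semi_ip_quad.
have -> : (- b x y / b x x) ^+ 2 * b x x + 2 * (- b x y / b x x) * b x y + b y y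
  = (b x x * b y y - b x y ^+ 2) / b x x by field.
by rewrite pmulr_lge0 ?invr_gt0// subr_ge0.
Qed.

Lemma semi_ip_triangle x y :
  Num.sqrt (b (x + y) (x + y)) <= Num.sqrt (b x x) + Num.sqrt (b y y).
Proof.
rewrite -(@ler_pXn2r _ 2)// ?nnegrE ?addr_ge0 ?sqrtr_ge0//.
have := semi_ip_quad 1 x y; rewrite scale1r expr1n mul1r mulr1 => E.
have bxy : b x y <= Num.sqrt (b x x) * Num.sqrt (b y y).
  rewrite -sqrtrM// (le_trans (ler_norm _))// -sqrtr_sqr.
  by rewrite ler_wsqrtr// semi_ip_cauchy_schwarz.
by rewrite sqrrD !sqr_sqrtr// E; lra.
Qed.

Lemma semi_ip_normZ a x :
  Num.sqrt (b (a *: x) (a *: x)) = `|a| * Num.sqrt (b x x).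
Proof.
have b0 z : b 0 z = 0 by have := bD 1 0 0 z; rewrite scaler0 addr0; lra.
rewrite -[a *: x]addr0 semi_ip_quad (bC x) !b0 mulr0 !addr0.
by rewrite sqrtrM ?sqr_ge0// sqrtr_sqr.
Qed.

End semi_inner_product.

Section smooth.
Context {R : realType}.
Implicit Types (f g : R3 R -> R) (i : 'I_3).

Definition basis_vec i : R3 R :=
  (((i : nat) == 0)%:R, ((i : nat) == 1)%:R, ((i : nat) == 2)%:R).

Definition pd i f : R3 R -> R := fun x => 'D_(basis_vec i) f x.

Definition smooth f := forall s : seq 'I_3,
  continuous (foldr pd f s) /\
  forall i x, derivable (foldr pd f s) x (basis_vec i).

Definition supp f : set (R3 R) := closure [set x | f x != 0].

Definition test_function (O : set (R3 R)) f :=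
  [/\ smooth f, compact (supp f) & supp f `<=` O].

Definition solenoidal_test_field (O : set (R3 R)) (phi : 'I_3 -> R3 R -> R) :=
  (forall j, test_function O (phi j)) /\
  forall x, \sum_i pd i (phi i) x = 0.

(* Near each boundary point the set is a strict sublevel set of a smooth
   function with nonvanishing gradient there. *)
Definition smooth_boundary (O : set (R3 R)) :=
  forall x0, (closure O `\` O^°) x0 ->
  exists U : set (R3 R), exists rho : R3 R -> R,
  [/\ open U, U x0, smooth rho, exists i, pd i rho x0 != 0
    & forall x, U x -> O x <-> rho x < 0].

Lemma foldr_pdD a f g s : smooth f -> smooth g ->
  foldr pd (fun x => a * f x + g x) s =
  (fun x => a * foldr pd f s x + foldr pd g s x).
Proof.
move=> sf sg; elim: s => //= i s ->; apply/funext => x.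
rewrite /pd; have [_ df] := sf s; have [_ dg] := sg s.
have daf : derivable (a *: foldr pd f s) x (basis_vec i) by exact: derivableZ.
by have := deriveD daf (dg i x); rewrite deriveZ.
Qed.

Lemma smoothD a f g : smooth f -> smooth g -> smooth (fun x => a * f x + g x).
Proof.
move=> sf sg s; rewrite foldr_pdD//; have [cf df] := sf s; have [cg dg] := sg s.
split=> [x|i x].
  by apply: cvgD; [apply: cvgMr; exact: cf|exact: cg].
by apply: derivableD => //; exact: derivableZ.
Qed.

Lemma test_functionD O a f g : test_function O f -> test_function O g ->
  test_function O (fun x => a * f x + g x).
Proof.
move=> [sf cf fO] [sg cg gO]; have sub : supp (fun x => a * f x + g x) `<=` supp f `|` supp g.
  rewrite -closureU; apply: closureS => x /=.
  have [->|] := eqVneq (f x) 0; last by left.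
  by rewrite mulr0 add0r; right.
split; first exact: smoothD.
  apply: (subclosed_compact _ (compactU cf cg) sub).
  exact: closed_closure.
by move=> x /sub[/fO|/gO].
Qed.

Lemma smooth0 : smooth (fun=> 0).
Proof.
move=> s; suff -> : foldr pd (fun=> 0) s = cst 0.
  by split=> [x|i x]; [exact: cvg_cst|exact: derivable_cst].
by elim: s => //= i s ->; apply/funext => x; rewrite /pd derive_cst.
Qed.

Lemma test_function0 O : test_function O (fun=> 0).
Proof.
have s0 : supp (fun=> 0) = set0.
  by rewrite /supp -[RHS]closure0; congr closure; apply/seteqP; split => x //=; rewrite eqxx.
by split; rewrite ?s0//; [exact: smooth0|exact: compact0].
Qed.

Lemma solenoidalD O a phi psi :
  solenoidal_test_field O phi -> solenoidal_test_field O psi ->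
  solenoidal_test_field O (fun j x => a * phi j x + psi j x).
Proof.
move=> [tf df] [tg dg]; split=> [j|x]; first exact: test_functionD.
transitivity (a * (\sum_i pd i (phi i) x) + \sum_i pd i (psi i) x); last first.
  by rewrite df dg mulr0 addr0.
rewrite mulr_sumr -big_split/=.
apply: eq_bigr => i _.
have [sf _ _] := tf i; have [sg _ _] := tg i.
by have /(congr1 (@^~ x)) := @foldr_pdD a _ _ [:: i] sf sg.
Qed.

End smooth.

Record smooth_domain (R : realType) := SmoothDomain {
  dom :> set (R3 R);
  dom_nonempty : dom !=set0;
  dom_open : open dom;
  dom_connected : connected dom;
  dom_bounded : bounded_set dom;
  dom_smooth : smooth_boundary dom }.

Section L2.
Context {R : realType} (Om : smooth_domain R).

Definition muO : {measure set (mR3 R) -> \bar R} :=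
  mrestr (@lebesgue3 R) (open_measurable3 (@dom_open R Om)).

(* square-integrable vector fields on [Om], before identification a.e. *)
Definition L2fun := {ffun 'I_3 -> LfunType muO (lee1n 2)}.

Definition null_field : {pred L2fun} :=
  fun u => `[< forall j, u j = 0 %[ae muO] >].

Lemma null_field_zmod_closed : zmod_closed null_field.
Proof.
split=> [|u v /asboolP u0 /asboolP v0]; apply/asboolP => j.
  by rewrite ffunE; exact: ae_eq_refl.
by rewrite !ffunE; have := ae_eq_sub (u0 j) (v0 j); apply: filterS => x /= + _ => /(_ Logic.I); rewrite subr0.
Qed.
HB.instance Definition _ :=
  GRing.isZmodClosed.Build L2fun null_field null_field_zmod_closed.

(* L^2(Om)^3 *)
Definition L2 : Type := Quotient.quot null_field.
HB.instance Definition _ := GRing.Zmodule.on L2.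
HB.instance Definition _ := EqQuotient.on L2.

Definition L2_val (u : L2) : 'I_3 -> R3 R -> R := fun j => repr u j : R3 R -> R.

Definition fun_ip (u v : L2fun) : R :=
  \sum_j \int[muO]_x (u j x * v j x).

Definition L2_ip (u v : L2) : R := fun_ip (repr u) (repr v).

Definition L2_scale (a : R) (u : L2) : L2 := \pi_L2 (a *: repr u).

Lemma null_field_scale a u : u \in null_field -> a *: u \in null_field.
Proof.
move=> /asboolP u0; apply/asboolP => j.
rewrite ffunE; apply: filterS (u0 j) => x /= + _ => /(_ Logic.I) ujx.
by transitivity (a * u j x) => //; rewrite ujx; exact: mulr0.
Qed.

Lemma L2_eqP (u v : L2fun) : \pi_L2 u = \pi_L2 v <-> u - v \in null_field.
Proof.
split=> [/eqP|uv]; first by rewrite -Quotient.idealrBE.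
by apply/eqP; rewrite -Quotient.idealrBE.
Qed.

Lemma repr_null (u : L2fun) : repr (\pi_L2 u) - u \in null_field.
Proof. by apply/L2_eqP; rewrite reprK. Qed.

Lemma pi_L2_scale a (u : L2fun) : \pi_L2 (a *: u) = L2_scale a (\pi_L2 u).
Proof.
apply/L2_eqP; rewrite -scalerBr; apply: null_field_scale.
by rewrite -opprB rpredN repr_null.
Qed.

Lemma pi_L2D (u v : L2fun) : \pi_L2 (u + v) = \pi_L2 u + \pi_L2 v.
Proof. exact: Quotient.pi_add. Qed.

Lemma pi_L2_surj (u : L2) : exists v : L2fun, u = \pi_L2 v.
Proof. by exists (repr u); rewrite reprK. Qed.

Lemma L2_scalerA a b u : L2_scale a (L2_scale b u) = L2_scale (a * b) u.
Proof. by have [v ->] := pi_L2_surj u; rewrite -!pi_L2_scale scalerA. Qed.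

Lemma L2_scale1r : left_id 1 L2_scale.
Proof. by move=> u; have [v ->] := pi_L2_surj u; rewrite -pi_L2_scale scale1r. Qed.

Lemma L2_scalerDr : right_distributive L2_scale +%R.
Proof.
move=> a u v; have [u' ->] := pi_L2_surj u; have [v' ->] := pi_L2_surj v.
by rewrite -!(pi_L2_scale, pi_L2D) scalerDr.
Qed.

Lemma L2_scalerDl u : {morph L2_scale^~ u : a b / a + b}.
Proof.
move=> a b /=; have [v ->] := pi_L2_surj u.
by rewrite -!pi_L2_scale scalerDl pi_L2D.
Qed.

HB.instance Definition _ := GRing.Zmodule_isLmodule.Build R L2
  L2_scalerA L2_scale1r L2_scalerDr L2_scalerDl.

Lemma fun_ip_integrable (u v : L2fun) j :
  muO.-integrable setT (EFin \o (fun x => u j x * v j x)).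
Proof.
have := @Lfun2_mul_Lfun1 _ _ _ muO (u j) (v j) (LfunP (u j)) (LfunP (v j)).
by move/Lfun1_integrable.
Qed.

Lemma fun_ipC u v : fun_ip u v = fun_ip v u.
Proof.
by apply: eq_bigr => j _; apply: eq_Rintegral => x _; rewrite mulrC.
Qed.

Lemma fun_ipDl a u v w : fun_ip (a *: u + v) w = a * fun_ip u w + fun_ip v w.
Proof.
rewrite mulr_sumr -big_split; apply: eq_bigr => j _ /=.
rewrite -RintegralZl//; last exact: fun_ip_integrable.
rewrite -RintegralD//; last 2 first.
- have := integrableZl measurableT a (fun_ip_integrable u w j).
  by apply: eq_integrable => // x _.
- exact: fun_ip_integrable.
by apply: eq_Rintegral => x _; rewrite !ffunE/= mulrDl mulrA.
Qed.

Lemma fun_ip_ge0 u : 0 <= fun_ip u u.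
Proof.
apply: sumr_ge0 => j _; apply: Rintegral_ge0 => x _.
by rewrite -expr2 sqr_ge0.
Qed.

Lemma fun_ip_null u v : u \in null_field -> fun_ip u v = 0.
Proof.
move=> /asboolP u0; apply: big1 => j _; rewrite /Rintegral.
rewrite (@ae_eq_integral _ _ _ muO setT (cst 0%E))//; first by rewrite integral0.
- by have /integrableP[] := fun_ip_integrable u v j.
- apply: filterS (u0 j) => x /= + _ => /(_ Logic.I) ->.
  by rewrite mul0r.
Qed.

Lemma fun_ip_eq0 u : fun_ip u u = 0 -> u \in null_field.
Proof.
move=> u0; apply/asboolP => j.
have uj0 : \int[muO]_x (u j x * u j x) = 0.
  move/eqP: u0; rewrite /fun_ip psumr_eq0; last first.
    by move=> i _; apply: Rintegral_ge0 => x _; rewrite -expr2 sqr_ge0.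
  by move=> /allP /(_ j); rewrite mem_index_enum => /(_ isT) /eqP.
have iuj := fun_ip_integrable u u j.
have : (\int[muO]_x `|(u j x * u j x)%:E| = 0)%E.
  transitivity (\int[muO]_x (u j x * u j x)%:E)%E.
    by apply: eq_integral => x _; rewrite /= ger0_norm// -expr2 sqr_ge0.
  rewrite -[LHS]fineK; first by rewrite -[fine _]/(Rintegral _ _ _) uj0.
  exact: integrable_fin_num.
move/(ae_eq_integral_abs muO measurableT (measurable_int _ iuj)).
apply: filterS => x /= + _ => /(_ Logic.I) [] /eqP.
by rewrite mulf_eq0 orbb => /eqP.
Qed.

Lemma fun_ip_pil (u v : L2fun) : fun_ip (repr (\pi_L2 u)) v = fun_ip u v.
Proof.
rewrite -[repr _](subrK u) -[repr _ - u]scale1r fun_ipDl fun_ip_null ?repr_null//.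
by rewrite mulr0 add0r.
Qed.

Lemma L2_ip_pi (u v : L2fun) : L2_ip (\pi_L2 u) (\pi_L2 v) = fun_ip u v.
Proof. by rewrite /L2_ip fun_ip_pil fun_ipC fun_ip_pil fun_ipC. Qed.

Lemma L2_ipC u v : L2_ip u v = L2_ip v u. Proof. exact: fun_ipC. Qed.

Lemma L2_ipDl a (u v w : L2) : L2_ip (a *: u + v) w = a * L2_ip u w + L2_ip v w.
Proof.
have [u' ->] := pi_L2_surj u; have [v' ->] := pi_L2_surj v.
have [w' ->] := pi_L2_surj w.
by rewrite -[a *: _]pi_L2_scale -pi_L2D !L2_ip_pi fun_ipDl.
Qed.

Lemma L2_ip0l w : L2_ip 0 w = 0.
Proof. by have := L2_ipDl 1 0 0 w; rewrite scaler0 addr0; lra. Qed.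

Lemma L2_ip_ge0 u : 0 <= L2_ip u u. Proof. exact: fun_ip_ge0. Qed.

Definition L2_norm u : R := Num.sqrt (L2_ip u u).

Lemma L2_normD (u v : L2) : L2_norm (u + v) <= L2_norm u + L2_norm v.
Proof. exact: semi_ip_triangle L2_ipC L2_ipDl L2_ip_ge0 u v. Qed.

Lemma L2_normZ a (u : L2) : L2_norm (a *: u) = `|a| * L2_norm u.
Proof. exact: semi_ip_normZ L2_ipC L2_ipDl a u. Qed.

Lemma L2_norm_eq0 (u : L2) : L2_norm u = 0 -> u = 0.
Proof.
move=> /eqP; rewrite sqrtr_eq0 => u0.
have /fun_ip_eq0 : L2_ip u u = 0 by apply/eqP; rewrite eq_le u0 L2_ip_ge0.
rewrite -[X in X \in _]subr0 => /L2_eqP; rewrite reprK => ->.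
by rewrite piE.
Qed.

HB.instance Definition _ := Lmodule_isNormed.Build R L2
  L2_normD L2_normZ L2_norm_eq0.

Lemma L2_normE (u : L2) : `|u| = Num.sqrt (L2_ip u u).
Proof. by []. Qed.

End L2.

Section function_spaces.
Context {R : realType} (Om : smooth_domain R).
Implicit Types (u v w g : L2 Om).

(* E, as a subset of L^2(Om)^3 *)
Definition E_space : set (L2 Om) := [set u | exists phi,
  solenoidal_test_field Om phi /\ forall j, L2_val u j = phi j %[ae muO Om]].

Lemma L2_valD a u v j : L2_val (a *: u + v) j =
  (fun x => a * L2_val u j x + L2_val v j x) %[ae muO Om].
Proof.
have : repr (a *: u + v) - (a *: repr u + repr v) \in null_field (Om := Om).
  by apply/L2_eqP; rewrite reprK pi_L2D pi_L2_scale !reprK.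
move=> /asboolP /(_ j); apply: filterS => x /= + _ => /(_ Logic.I).
by rewrite !ffunE => /eqP; rewrite subr_eq0 => /eqP.
Qed.

Lemma E_space0 : E_space 0.
Proof.
exists (fun _ => fun=> 0); split=> [|j].
  split=> [j|x]; first exact: test_function0.
  by rewrite big1// => i _; rewrite /pd derive_cst.
have : repr (0 : L2 Om) - 0 \in null_field (Om := Om).
  by apply/L2_eqP; rewrite reprK piE.
move=> /asboolP /(_ j); apply: filterS => x /= + _ => /(_ Logic.I).
by rewrite subr0.
Qed.

Lemma E_spaceD a u v : E_space u -> E_space v -> E_space (a *: u + v).
Proof.
move=> [f [sf uf]] [g [sg vg]]; exists (fun j x => a * f j x + g j x); split.
  exact: solenoidalD.
move=> j; move: (L2_valD a u v j) (uf j) (vg j).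
have F : Filter (nbhs (almost_everywhere (muO Om))) by exact: ae_filter_ringOfSetsType.
apply: (@filterS3 _ _ F) => x /= + + + _.
by move=> /(_ Logic.I) -> /(_ Logic.I) -> /(_ Logic.I) ->.
Qed.

(* closure of E in L^2 *)
Definition H_set : set (L2 Om) := closure E_space.
Definition H_pred : {pred L2 Om} := mem H_set.

Lemma closure_normP (A : set (L2 Om)) u :
  closure A u <-> forall e, 0 < e -> exists2 v, A v & `|u - v| < e.
Proof.
split=> [Au e e0|h B /nbhs_ballP[e /= e0 eB]].
  have [v [Av uv]] := Au _ (nbhsx_ballx u _ e0).
  by exists v => //; rewrite -ball_normE in uv.
have [v Av uv] := h e e0; exists v; split => //.
by apply: eB; rewrite -ball_normE.
Qed.

Lemma H_submod_closed : submod_closed H_pred.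
Proof.
split=> [|a u v /set_mem Hu /set_mem Hv]; apply: mem_set.
  exact/subset_closure/E_space0.
apply/closure_normP => e e0.
have a0 : 0 < `|a| + 1 by rewrite ltr_wpDl.
have [u' Eu uu'] := (closure_normP _ _).1 Hu _ (divr_gt0 (divr_gt0 e0 a0) (ltr0Sn R 1)).
have [v' Ev vv'] := (closure_normP _ _).1 Hv _ (divr_gt0 e0 (ltr0Sn R 1)).
exists (a *: u' + v'); first exact: E_spaceD.
have -> : a *: u + v - (a *: u' + v') = a *: (u - u') + (v - v').
  by rewrite scalerBr opprD addrACA.
rewrite (le_lt_trans (ler_normD _ _))// normrZ (splitr e) ler_ltD//.
rewrite (le_trans (ler_wpM2l (normr_ge0 a) (ltW uu')))//.
rewrite [leLHS](_ : _ = (e / 2) * (`|a| / (`|a| + 1))); last by field; lra.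
by rewrite ler_piMr ?divr_ge0 ?(ltW e0)// ler_pdivrMr// mul1r lerDl.
Qed.
HB.instance Definition _ :=
  GRing.isSubmodClosed.Build R (L2 Om) H_pred H_submod_closed.

Record H_space := HSpace { H_val :> L2 Om ; H_valP : H_val \in H_pred }.
HB.instance Definition _ := [isSub of H_space for H_val].
HB.instance Definition _ := [Choice of H_space by <:].
HB.instance Definition _ := [SubChoice_isSubLmodule of H_space by <:].

Definition H_norm (u : H_space) : R := `|H_val u|.

Lemma H_normD (u v : H_space) : H_norm (u + v) <= H_norm u + H_norm v.
Proof. exact: ler_normD. Qed.
Lemma H_normZ a (u : H_space) : H_norm (a *: u) = `|a| * H_norm u.
Proof. exact: normrZ. Qed.
Lemma H_norm_eq0 (u : H_space) : H_norm u = 0 -> u = 0.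
Proof. by move/normr0_eq0 => u0; apply: val_inj. Qed.
HB.instance Definition _ := Lmodule_isNormed.Build R H_space
  H_normD H_normZ H_norm_eq0.


End function_spaces.

Section sobolev.
Context {R : realType} (Om : smooth_domain R).
Implicit Types (u v w g : L2 Om).
(* [g] is the weak i-th partial derivative of [u] in [Om] *)
Definition weak_pd (i : 'I_3) u g := forall j psi, test_function Om psi ->
  \int[muO Om]_x (L2_val u j x * pd i psi x) =
  - \int[muO Om]_x (L2_val g j x * psi x).

Definition H1_set : set (L2 Om) := [set u | forall i, exists g, weak_pd i u g].

(* meaningful on [H1_set], where the weak derivative exists and is unique *)
Definition weak_D (i : 'I_3) u : L2 Om := xget 0 [set g | weak_pd i u g].

Definition H2_set : set (L2 Om) := [set u | H1_set u /\ forall i, H1_set (weak_D i u)].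

Definition laplacian u : L2 Om := \sum_i weak_D i (weak_D i u).

Definition H1_norm u : R := Num.sqrt (`|u| ^+ 2 + \sum_i `|weak_D i u| ^+ 2).

(* closure of E in H^1 *)
Definition V_set : set (L2 Om) := [set u | H1_set u /\
  forall e, 0 < e -> exists2 phi, E_space phi & H1_norm (u - phi) < e].

Definition V_ip u v : R := \sum_i L2_ip (weak_D i u) (weak_D i v).
Definition V_norm u : R := Num.sqrt (V_ip u u).

(* Elements of the dual of V; only their values on V matter. *)
Definition V'_set : set (L2 Om -> R) := [set f |
  (forall a u v, V_set u -> V_set v -> f (a *: u + v) = a * f u + f v) /\
  exists C, forall v, V_set v -> `|f v| <= C * V_norm v].

Definition V'_norm (f : L2 Om -> R) : R :=
  sup [set `|f v| | v in [set v | V_set v /\ V_norm v <= 1]].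

Definition H_to_V' (h : H_space Om) : L2 Om -> R := L2_ip h.

(* orthogonal projection of L^2 onto H *)
Definition leray w : L2 Om :=
  xget 0 [set h | H_set h /\ forall z, H_set z -> L2_ip (w - h) z = 0].

Definition stokes_dom : set (L2 Om) := V_set `&` H2_set.
Definition stokes u : L2 Om := leray (- laplacian u).

(* b(u, v, w) *)
Definition trilinear u v w : R := \sum_i \sum_j
  \int[muO Om]_x (L2_val u i x * L2_val (weak_D i v) j x * L2_val w j x).

(* Indexed from 0: [lambda 0] is the first eigenvalue. *)
Record stokes_spectrum := StokesSpectrum {
  lambda : nat -> R ;
  omega : nat -> L2 Om ;
  lambda0_gt0 : 0 < lambda 0 ;
  lambda_nd : {homo lambda : m n / (m <= n)%N >-> m <= n} ;
  omega_dom : forall j, stokes_dom (omega j) ;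
  omega_eigen : forall j, stokes (omega j) = lambda j *: omega j ;
  omega_orthonormal : forall i j, L2_ip (omega i) (omega j) = (i == j)%:R ;
  omega_basis : forall u, H_set u ->
    series (fun j => L2_ip u (omega j) *: omega j) @ \oo --> u }.

End sobolev.

Section fractional_powers.
Context {R : realType} (Om : smooth_domain R) (sp : stokes_spectrum Om).
Variable s : R.
Implicit Types u v : H_space Om.

Definition Apow_series (u : L2 Om) : nat -> L2 Om :=
  series (fun j => (lambda sp j `^ s * L2_ip u (omega sp j)) *: omega sp j).

Definition Apow_dom : set (L2 Om) := [set u | H_set u /\ cvgn (Apow_series u)].
Definition Apow (u : L2 Om) : L2 Om := limn (Apow_series u).

Lemma Apow_seriesD a (u v : L2 Om) :
  Apow_series (a *: u + v) = (fun n => a *: Apow_series u n + Apow_series v n).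
Proof.
apply/funext => n; rewrite /Apow_series /series/= scaler_sumr -big_split/=.
apply: eq_bigr => j _; rewrite L2_ipDl scalerA -scalerDl; congr (_ *: _).
by ring.
Qed.

Lemma Apow_series_cvgD a (u v : L2 Om) : cvgn (Apow_series u) ->
  cvgn (Apow_series v) ->
  Apow_series (a *: u + v) @ \oo --> a *: Apow u + Apow v.
Proof.
move=> cu cv; rewrite Apow_seriesD.
apply: cvgD; [exact: cvgZl_tmp cu|exact: cv].
Qed.

Definition DA_pred : {pred H_space Om} := mem [set u : H_space Om | Apow_dom u].

Lemma DA_submod_closed : submod_closed DA_pred.
Proof.
split=> [|a u v /set_mem[_ cu] /set_mem[_ cv]]; apply: mem_set.
  split; first exact: set_mem (H_valP _).
  suff -> : Apow_series (H_val (0 : H_space Om)) = fun=> 0 by exact: is_cvg_cst.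
  apply/funext => n; rewrite /Apow_series /series/= big1// => j _.
  transitivity ((lambda sp j `^ s * 0) *: omega sp j).
    by congr (_ * _ *: _); exact: L2_ip0l.
  by rewrite mulr0 scale0r.
split; first exact: set_mem (H_valP _).
have h := @Apow_series_cvgD a _ _ cu cv.
exact: cvgP h.
Qed.
HB.instance Definition _ :=
  GRing.isSubmodClosed.Build R (H_space Om) DA_pred DA_submod_closed.

(* D(A^s) with the norm |A^s u| *)
Record DA_space := DASpace { DA_val :> H_space Om ; DA_valP : DA_val \in DA_pred }.
HB.instance Definition _ := [isSub of DA_space for DA_val].
HB.instance Definition _ := [Choice of DA_space by <:].
HB.instance Definition _ := [SubChoice_isSubLmodule of DA_space by <:].

Definition DA_norm (u : DA_space) : R := `|Apow u|.

Lemma DA_cvg (u : DA_space) : cvgn (Apow_series u).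
Proof. by have [] := set_mem (DA_valP u). Qed.

Lemma DA_ApowD a (u v : DA_space) :
  Apow (a *: u + v : DA_space) = a *: Apow u + Apow v.
Proof.
have h := @Apow_series_cvgD a _ _ (@DA_cvg u) (@DA_cvg v).
exact: (cvg_lim (@norm_hausdorff _ _) h).
Qed.

Lemma DA_normD (u v : DA_space) : DA_norm (u + v) <= DA_norm u + DA_norm v.
Proof.
rewrite /DA_norm -[u in Apow (u + _ : DA_space)]scale1r DA_ApowD scale1r.
exact: ler_normD.
Qed.

Lemma DA_Apow0 : Apow (0 : DA_space) = 0.
Proof.
have := DA_ApowD 1 0 0; rewrite scaler0 addr0 scale1r => /eqP.
by rewrite -subr_eq subrr => /eqP.
Qed.

Lemma DA_normZ a (u : DA_space) : DA_norm (a *: u) = `|a| * DA_norm u.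
Proof.
by rewrite /DA_norm -[_ *: _]addr0 DA_ApowD DA_Apow0 addr0 normrZ.
Qed.

Lemma L2_ip_le (x y : L2 Om) : `|L2_ip x y| <= `|x| * `|y|.
Proof.
rewrite !L2_normE -sqrtrM ?L2_ip_ge0// -sqrtr_sqr ler_wsqrtr//.
exact: semi_ip_cauchy_schwarz (@L2_ipC _ Om) (@L2_ipDl _ Om) (@L2_ip_ge0 _ Om) _ _.
Qed.

Lemma L2_ip_cvg0 (x : nat -> L2 Om) y l :
  x @ \oo --> (0 : L2 Om) -> (forall n, (n > l)%N -> L2_ip (x n) y = L2_ip (x l.+1) y) ->
  L2_ip (x l.+1) y = 0.
Proof.
move=> x0 xl; apply/eqP/negPn/negP => ip0.
have d0 : 0 < `|L2_ip (x l.+1) y| / (`|y| + 1).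
  by rewrite divr_gt0 ?normr_gt0// ltr_wpDl.
have /cvgr0Pnorm_lt /(_ _ d0) [N _ hN] := x0.
have := hN (maxn N l.+1) (leq_maxl _ _).
apply/negP; rewrite -leNgt ler_pdivrMr ?ltr_wpDl//.
rewrite -(xl (maxn N l.+1)) ?leq_maxr// (le_trans (L2_ip_le _ _))//.
by rewrite ler_wpM2l// lerDl.
Qed.

Lemma DA_norm_eq0 (u : DA_space) : DA_norm u = 0 -> u = 0.
Proof.
move/normr0_eq0 => Au0; have cu : Apow_series u @ \oo --> (0 : L2 Om).
  by rewrite -Au0; exact: DA_cvg.
have lam_gt0 j : 0 < lambda sp j.
  by rewrite (lt_le_trans (lambda0_gt0 sp))//; exact: lambda_nd.
have ip_sum (f : nat -> R) n k : L2_ip (\sum_(0 <= j < n) f j *: omega sp j) (omega sp k)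
    = if (k < n)%N then f k else 0.
  elim: n => [|n IH].
    by rewrite big_geq// L2_ip0l.
  rewrite big_nat_recr//= addrC L2_ipDl IH omega_orthonormal ltnS.
  by case: ltngtP => [kn|nk|->]; rewrite ?mulr0 ?add0r ?mulr1 ?addr0.
have ui0 j : L2_ip u (omega sp j) = 0.
  have h n : (n > j)%N -> L2_ip (Apow_series u n) (omega sp j) =
      lambda sp j `^ s * L2_ip u (omega sp j).
    by move=> jn; rewrite /Apow_series /series/= ip_sum jn.
  have /eqP : L2_ip (Apow_series u j.+1) (omega sp j) = 0.
    by apply: L2_ip_cvg0 cu _ => n jn; rewrite !h.
  by rewrite h// mulf_eq0 gt_eqF ?powR_gt0//= => /eqP.
do 2 apply: val_inj => /=.
have Hu : H_set (u : L2 Om) := set_mem (H_valP _).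
have := omega_basis sp Hu; rewrite (_ : series _ = fun=> 0) => [u_cvg|].
  exact: (@cvg_unique (L2 Om) (@norm_hausdorff R (L2 Om)) _ _ _ _ u_cvg
    (cvg_cst 0)).
by apply/funext => n; rewrite /series/= big1// => j _; rewrite ui0 scale0r.
Qed.
HB.instance Definition _ := Lmodule_isNormed.Build R DA_space
  DA_normD DA_normZ DA_norm_eq0.

End fractional_powers.

Section bochner.
Context {R : realType} (E : zmodType).

Definition simple_map (s : R -> E) :=
  finite_set (range s) /\
  forall x, measurable (s @^-1` [set x] : set (measurableTypeR R)).

(* [u] is strongly measurable on [D] with values in the space [X] normed by [N] *)
Definition strongly_measurable (X : set E) (N : E -> R) (D : set R) (u : R -> E) :=
  exists s : nat -> R -> E,
    (forall n, simple_map (s n) /\ forall t, X (s n t)) /\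
    {ae @lebesgue_measure R, forall t, D t ->
      X (u t) /\ N (s n t - u t) @[n --> \oo] --> (0 : R)}.

Definition bochner_Lp (p : nat) (X : set E) (N : E -> R) (a b : R) (u : R -> E) :=
  strongly_measurable X N `]a, b[ u /\
  (\int[@lebesgue_measure R]_(t in `]a, b[) (N (u t) ^+ p)%:E < +oo)%E.

Definition bochner_Loo (X : set E) (N : E -> R) (a b : R) (u : R -> E) :=
  strongly_measurable X N `]a, b[ u /\
  exists M : R, {ae @lebesgue_measure R, forall t, `]a, b[%classic t -> N (u t) <= M}.

Definition bochner_L2loc (X : set E) (N : E -> R) (u : R -> E) :=
  forall a b : R, a < b -> bochner_Lp 2 X N a b u.

(* int_{-oo}^t e^{mu s} N(u(s))^2 ds < +oo for all t *)
Definition backward_integrable (mu : R) (N : E -> R) (u : R -> E) :=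
  forall t : R, (\int[@lebesgue_measure R]_(s in `]-oo, t])
    (expR (mu * s) * N (u s) ^+ 2)%:E < +oo)%E.

End bochner.

Section solutions.
Context {R : realType} (Om : smooth_domain R) (nu nu0 : R).

Definition test_function1 (I : set R) (eta : R -> R) :=
  [/\ forall n x, derivable (derive1n n eta) x 1,
      compact (closure [set t | eta t != 0]) &
      closure [set t | eta t != 0] `<=` I].

(* [u] is the representative in C([tau, +oo[; H) of a weak solution, which is
   what gives a meaning to [u tau = u0]. *)
Definition weak_solution (f : R -> L2 Om -> R) (tau : R) (u0 : H_space Om)
    (u : R -> H_space Om) :=
  [/\ {within `[tau, +oo[, continuous u},
      u tau = u0,
      forall T, tau < T ->
        bochner_Loo setT Num.norm tau T u /\
        bochner_Lp 4 (@V_set R Om) (@V_norm R Om) tau T (fun t => H_val (u t)) &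
      forall v, V_set v -> forall eta, test_function1 `]tau, +oo[ eta ->
        \int[@lebesgue_measure R]_(t in `]tau, +oo[)
          (- (L2_ip (u t) v * derive1 eta t)
           + ((nu + nu0 * V_norm (u t) ^+ 2) * V_ip (u t) v
              + trilinear (u t) (u t) v) * eta t)
        = \int[@lebesgue_measure R]_(t in `]tau, +oo[) (f t v * eta t)].

Definition regular_solution (sp : stokes_spectrum Om) (f : R -> H_space Om)
    (tau : R) (u0 : DA_space sp 4^-1) (u : R -> DA_space sp 4^-1) :=
  [/\ weak_solution (fun t => H_to_V' (f t)) tau u0 (fun t => DA_val (u t)),
      {within `[tau, +oo[, continuous u},
      u tau = u0 &
      forall T, tau < T ->
        bochner_Lp 2 (Apow_dom sp (3 / 4)) (fun x => `|Apow sp (3 / 4) x|)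
          tau T (fun t => H_val (DA_val (u t)))].

(* By uniqueness of the solutions, these predicates determine S(t, tau) for
   t >= tau; S(t, tau) is irrelevant for t < tau. *)
Definition weak_solution_process (f : R -> L2 Om -> R)
    (S : R -> R -> H_space Om -> H_space Om) :=
  forall tau u0, weak_solution f tau u0 (fun t => S t tau u0).

Definition regular_solution_process (sp : stokes_spectrum Om)
    (f : R -> H_space Om)
    (S : R -> R -> DA_space sp 4^-1 -> DA_space sp 4^-1) :=
  forall tau u0, regular_solution f tau u0 (fun t => S t tau u0).

End solutions.

Section pullback_attractors.
Context {R : realType} {X : normedModType R}.
Implicit Types (S : R -> R -> X -> X) (U : set (R -> set X)) (A B D : R -> set X).

Definition hausdorff_semidist (B1 B2 : set X) : \bar R :=
  ereal_sup [set ereal_inf [set `|x - y|%:E | y in B2] | x in B1].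

Definition universe_mu (mu : R) : set (R -> set X) := [set D |
  (forall t, D t !=set0 /\ bounded_set (D t)) /\
  exists rho : R -> R,
    [/\ continuous rho, forall t, 0 <= rho t,
        forall t, D t `<=` [set x | `|x| <= rho t] &
        rho tau ^+ 2 * expR (mu * tau) @[tau --> -oo] --> (0 : R)]].

Definition universe_F : set (R -> set X) := [set D |
  exists B : set X, [/\ B !=set0, bounded_set B & forall t, D t = B]].

Definition pullback_attracting S U A :=
  forall t D, U D ->
    hausdorff_semidist (S t tau @` D tau) (A t) @[tau --> -oo] --> 0%E.

Definition pullback_attractor S U A :=
  [/\ forall t, A t !=set0 /\ compact (A t),
      forall t tau, tau <= t -> S t tau @` A tau = A t &
      pullback_attracting S U A].

Definition minimal_pullback_attractor S U A :=
  pullback_attractor S U A /\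
  forall C, (forall t, closed (C t)) -> pullback_attracting S U C ->
    forall t, A t `<=` C t.

Definition pullback_absorbing S U B :=
  forall t D, U D ->
    exists2 T, T < t & forall tau, tau <= T -> S t tau @` D tau `<=` B t.

End pullback_attractors.

(* Main.v *)
Require Import Defs.
From HB Require Import structures.
From mathcomp Require Import all_boot all_order all_algebra.
From mathcomp Require Import all_classical all_reals all_analysis.
Set Implicit Arguments. Unset Strict Implicit. Unset Printing Implicit Defensive.
Import Order.TTheory GRing.Theory Num.Theory.
Import numFieldNormedType.Exports.
Local Open Scope classical_set_scope.
Local Open Scope ring_scope.

(** Both phase spaces are treated at once, by an argument about pullback
    attractors in a normed space [X].

    The inclusions follow from those of the universes.  A constant bounded
    family is tempered for every [mu > 0], because [exp (mu tau)] tends to [0]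
    at [-oo] ([universe_F_mu]); and for [mu <= mu'] the weight [exp (mu' tau)]
    is below [exp (mu tau)] when [tau <= 0] ([universe_mu_le]).  An attractor
    for the larger universe is a closed family attracting the smaller one, so
    it contains the minimal attractor of the latter
    ([minimal_attractor_subset]).

    For the equalities, the closure of an absorbing family is closed and
    attracting, so by minimality it contains the attractor
    ([minimal_attractor_closure_absorbing]).  If the absorbing sets are
    uniformly bounded for times up to [T], then so is the attractor, and the
    union [B] of its sections before [T] is one bounded set.  By invariance
    the section at time [t <= T] is contained in [S t tau @` B] for all
    [tau <= t]; the attractor of the constant families attracts [B], and hence
    contains that section ([invariant_subset_attractor]).  This closes the
    chain of inclusions. *)

Section hausdorff_semidistance.
Context {R : realType} {X : normedModType R}.
Implicit Types A B : set X.

Lemma hausdorff_semidistS A B B' :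
  B `<=` B' -> (hausdorff_semidist B A <= hausdorff_semidist B' A)%E.
Proof. by move=> BB'; apply: ereal_sup_le; exact: image_subset. Qed.

(** Nonemptiness matters: the supremum over the empty set is [-oo]. *)
Lemma hausdorff_semidist_subset0 A B :
  B !=set0 -> B `<=` A -> hausdorff_semidist B A = 0%E.
Proof.
move=> [x0 Bx0] BA.
have d0 x : B x -> ereal_inf [set `|x - y|%:E | y in A] = 0%E.
  move=> Bx; apply/eqP; rewrite eq_le; apply/andP; split.
    by apply: ereal_inf_lbound; exists x; [exact: BA|rewrite subrr normr0].
  by apply/ereal_infP => _ [y _ <-]; rewrite lee_fin.
rewrite /hausdorff_semidist (_ : [set _ | _ in _] = [set 0%E]) ?ereal_sup1//.
apply/seteqP; split=> [_ [x /d0 <- <-//]|_ ->].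
by exists x0; rewrite // d0.
Qed.

Lemma hausdorff_semidist_le0_subset A B : closed A ->
  (hausdorff_semidist B A <= 0)%E -> B `<=` A.
Proof.
move=> cA dBA x Bx; apply: cA => U /nbhs_ballP[e /= e0 eU].
have : (ereal_inf [set `|x - y|%:E | y in A] < e%:E)%E.
  apply: (@le_lt_trans _ _ 0%E); last by rewrite lte_fin.
  by apply: le_trans dBA; apply: ereal_sup_ubound; exists x.
move=> /ereal_inf_lt[_ [y Ay <-]]; rewrite lte_fin => xye.
by exists y; split=> //; apply: eU; rewrite -ball_normE.
Qed.

End hausdorff_semidistance.

Section universes.
Context {R : realType} {X : normedModType R}.
Implicit Types mu : R.

Lemma universe_F_mu mu : 0 < mu ->
  @universe_F R X `<=` universe_mu mu.
Proof.
move=> mu0 D [B [B0 bB DB]]; split=> [t|]; first by rewrite DB.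
have [M [_ hM]] := bB; exists (fun=> `|M| + 1); split.
- by move=> t; exact: cvg_cst.
- by move=> _; rewrite addr_ge0.
- move=> t x /=; rewrite DB => Bx; apply: hM => //.
  by rewrite ltr_pwDr// ler_norm.
- rewrite -[X in _ --> X](mulr0 ((`|M| + 1) ^+ 2)).
  apply: cvgMr; apply/cvgNy_compNP.
  rewrite [X in X @ _ --> _](_ : _ = (fun y => expR (- y)) \o *%R mu); last first.
    by apply/funext => y /=; rewrite mulrN.
  apply: cvg_comp (@cvgr_expR R).
  exact: gt0_cvgMry.
Qed.

Lemma universe_mu_le mu mu' : mu <= mu' ->
  @universe_mu R X mu `<=` universe_mu mu'.
Proof.
move=> le_mu D [Db [rho [crho rho0 Drho rho_cvg]]]; split=> //.
exists rho; split=> //.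
apply: (squeeze_cvgr _ (cvg_cst (0 : R)) rho_cvg).
(* The weights compare in this direction for [s <= 0]. *)
near=> s; rewrite mulr_ge0 ?sqr_ge0 ?expR_ge0//=.
rewrite ler_wpM2l ?sqr_ge0// ler_expR ler_wnM2r//.
Unshelve. all: by end_near. Qed.

End universes.

Section attractors.
Context {R : realType} {X : normedModType R}.
Implicit Types (S : R -> R -> X -> X) (U : set (R -> set X)).
Implicit Types (A B C D : R -> set X) (T : R).

Lemma pullback_attractor_closed S U A :
  pullback_attractor S U A -> forall t, closed (A t).
Proof.
case=> cA _ _ t; apply: compact_closed; first exact: norm_hausdorff.
by have [] := cA t.
Qed.

Lemma minimal_attractor_subset S U U' A A' : U `<=` U' ->
  minimal_pullback_attractor S U A -> pullback_attractor S U' A' ->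
  forall t, A t `<=` A' t.
Proof.
move=> UU' [_ minA] attA'; apply: minA; first exact: pullback_attractor_closed attA'.
by case: attA' => _ _ attr t D /UU'; exact: attr.
Qed.

(** The closure of an absorbing family is a closed attracting family: the
    semidistance to it is eventually [0]. *)
Lemma minimal_attractor_closure_absorbing S U A D :
  (forall E t, U E -> E t !=set0) ->
  minimal_pullback_attractor S U A -> pullback_absorbing S U D ->
  forall t, A t `<=` closure (D t).
Proof.
move=> U0 [_ minA] absD; apply: minA => [t|t E UE]; first exact: closed_closure.
have [s _ SE] := absD t E UE.
apply: cvg_near_cst; near=> tau.
apply: hausdorff_semidist_subset0.
  by have [x Ex] := U0 E tau UE; exists (S t tau x), x.
apply: subset_trans (@subset_closure _ _); apply: SE.
by near: tau; apply: nbhs_ninfty_le; exact: num_real.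
Unshelve. all: by end_near. Qed.

(** By invariance [A t] is the image of [A tau] for every [tau <= t], and all
    these sections lie in one bounded set, which [AF] attracts. *)
Lemma invariant_subset_attractor S A AF T :
  A T !=set0 -> (forall t tau, tau <= t -> S t tau @` A tau = A t) ->
  bounded_set (\bigcup_(t in [set t | t <= T]) A t) ->
  pullback_attractor S universe_F AF ->
  forall t, t <= T -> A t `<=` AF t.
Proof.
move=> [x0 Ax0] invA bA attAF t tT.
set B := \bigcup_(_ in _) _ in bA.
have UB : universe_F (fun=> B).
  by exists B; split=> //; exists x0, T => //=.
apply: hausdorff_semidist_le0_subset.
  exact: pullback_attractor_closed attAF t.
have [_ _ /(_ t _ UB) attB] := attAF.
apply: (cvge_to_ge attB); near=> tau.
have tau_t : tau <= t by near: tau; apply: nbhs_ninfty_le; exact: num_real.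
rewrite -(invA _ _ tau_t); apply: hausdorff_semidistS; apply: image_subset.
by move=> x Ax; exists tau => //=; exact: le_trans tT.
Unshelve. all: by end_near. Qed.

Lemma bounded_set_bigcup_closure (I : Type) (J : set I) (F G : I -> set X) :
  (forall i, J i -> G i `<=` closure (F i)) ->
  bounded_set (\bigcup_(i in J) F i) -> bounded_set (\bigcup_(i in J) G i).
Proof.
move=> GF [M [Mr hM]]; exists M; split=> // N MN x [i Ji /(GF i Ji) Fx].
suff : closed_ball_ Num.norm 0 N x by rewrite /closed_ball_/= sub0r normrN.
have cN := @closed_closed_ball_ _ X 0 N.
apply: cN; apply: closureS Fx => y Fy.
by rewrite /closed_ball_/= sub0r normrN; apply: hM => //; exists i.
Qed.

Lemma attractors_nested S AF (Amu : R -> R -> set X) (mu mu0 : R) :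
  minimal_pullback_attractor S universe_F AF ->
  (forall mu, 0 < mu <= mu0 ->
    minimal_pullback_attractor S (universe_mu mu) (Amu mu)) ->
  0 < mu <= mu0 ->
  forall t, AF t `<=` Amu mu t /\ Amu mu t `<=` Amu mu0 t.
Proof.
move=> minF minmu hmu t; have /andP[mu_gt0 mu_le] := hmu.
have mu0P : 0 < mu0 <= mu0 by rewrite (lt_le_trans mu_gt0)/=.
have [attmu _] := minmu _ hmu; have [attmu0 _] := minmu _ mu0P; split.
  exact: minimal_attractor_subset (universe_F_mu mu_gt0) minF attmu t.
exact: minimal_attractor_subset (universe_mu_le mu_le) (minmu _ hmu) attmu0 t.
Qed.

Lemma attractors_coincide S AF (Amu : R -> R -> set X) (mu mu0 : R) D T :
  minimal_pullback_attractor S universe_F AF ->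
  (forall mu, 0 < mu <= mu0 ->
    minimal_pullback_attractor S (universe_mu mu) (Amu mu)) ->
  pullback_absorbing S (universe_mu mu0) D ->
  bounded_set (\bigcup_(t in [set t | t <= T]) D t) ->
  0 < mu <= mu0 ->
  forall t, t <= T -> AF t = Amu mu t /\ Amu mu t = Amu mu0 t.
Proof.
move=> minF minmu absD bD hmu t tT; have /andP[mu_gt0 mu_le] := hmu.
have [Fmu mumu0] := attractors_nested minF minmu hmu t.
have mu0P : 0 < mu0 <= mu0 by rewrite (lt_le_trans mu_gt0)/=.
have [[cA invA _] _] := minmu _ mu0P.
have bA : bounded_set (\bigcup_(t in [set t | t <= T]) Amu mu0 t).
  apply: bounded_set_bigcup_closure bD => s _.
  apply: minimal_attractor_closure_absorbing (minmu _ mu0P) absD s.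
  by move=> E s [/(_ s)[]].
have mu0F : Amu mu0 t `<=` AF t.
  by apply: invariant_subset_attractor bA (proj1 minF) _ tT; case: (cA T).
by split; apply/seteqP; split=> // x; [move=> /mumu0/mu0F|move=> /mu0F/Fmu].
Qed.

End attractors.

Theorem theorem3p12 (R : realType) (Om : smooth_domain R)
    (sp : stokes_spectrum Om) (nu nu0 : R) (hnu : 0 < nu) (hnu0 : 0 < nu0)
    (T : R) :
  let mu0 := nu * lambda sp 0 in
  (forall (f : R -> L2 Om -> R)
      (S : R -> R -> H_space Om -> H_space Om)
      (AF : R -> set (H_space Om)) (Amu : R -> R -> set (H_space Om)),
    bochner_L2loc (@V'_set R Om) (@V'_norm R Om) f ->
    (exists2 mus, 0 < mus <= mu0 & backward_integrable mus (@V'_norm R Om) f) ->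
    weak_solution_process nu nu0 f S ->
    minimal_pullback_attractor S universe_F AF ->
    (forall mu, 0 < mu <= mu0 ->
      minimal_pullback_attractor S (universe_mu mu) (Amu mu)) ->
    (forall mu t, 0 < mu <= mu0 ->
      AF t `<=` Amu mu t /\ Amu mu t `<=` Amu mu0 t) /\
    (forall D : R -> set (H_space Om),
      pullback_absorbing S (universe_mu mu0) D ->
      bounded_set (\bigcup_(t in [set t | t <= T]) D t) ->
      forall mu t, 0 < mu <= mu0 -> t <= T ->
      AF t = Amu mu t /\ Amu mu t = Amu mu0 t)) /\
  (forall (f : R -> H_space Om)
      (S : R -> R -> DA_space sp 4^-1 -> DA_space sp 4^-1)
      (AF : R -> set (DA_space sp 4^-1)) (Amu : R -> R -> set (DA_space sp 4^-1)),
    bochner_L2loc setT Num.norm f ->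
    (exists2 mus, 0 < mus <= mu0 & backward_integrable mus Num.norm f) ->
    regular_solution_process nu nu0 f S ->
    minimal_pullback_attractor S universe_F AF ->
    (forall mu, 0 < mu <= mu0 ->
      minimal_pullback_attractor S (universe_mu mu) (Amu mu)) ->
    (forall mu t, 0 < mu <= mu0 ->
      AF t `<=` Amu mu t /\ Amu mu t `<=` Amu mu0 t) /\
    (forall D : R -> set (DA_space sp 4^-1),
      pullback_absorbing S (universe_mu mu0) D ->
      bounded_set (\bigcup_(t in [set t | t <= T]) D t) ->
      forall mu t, 0 < mu <= mu0 -> t <= T ->
      AF t = Amu mu t /\ Amu mu t = Amu mu0 t)).
Proof.
move=> mu0; split=> f S AF Amu _ _ _ minF minmu; split.
- by move=> mu t hmu; exact: attractors_nested minF minmu hmu t.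
- by move=> D absD bD mu t hmu; exact: attractors_coincide minF minmu absD bD hmu t.
- by move=> mu t hmu; exact: attractors_nested minF minmu hmu t.
- by move=> D absD bD mu t hmu; exact: attractors_coincide minF minmu absD bD hmu t.
Qed.
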